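(* \textsc{Upper Clique Transversal} can be solved in linear time in the class of cographs. That is, there is an algorithm that, given a cograph $G=(V,E)$ and an integer $k$, decides in time $\mathcal{O}(|V|+|E|)$ whether $G$ contains a minimal clique transversal $S$ with $|S|\ge k$.
   Context: All graphs are finite, simple, and undirected. A clique is a set of pairwise adjacent vertices; it is maximal if it is not properly contained in another clique. A clique transversal in $G$ is a set $S\subseteq V(G)$ that intersects every maximal clique of $G$; it is minimal if it does not contain any other clique transversal. \textsc{Upper Clique Transversal} is the decision problem: given a graph $G$ and an integer $k$, does $G$ contain a minimal clique transversal $S$ such that $|S|\ge k$? The class of cographs is defined recursively: the one-vertex graph $K_1$ is a cograph; the disjoint union of two cographs is a cograph; the join of two cographs $G_1,G_2$ (the graph obtained from their disjoint union by adding all edges with one endpoint in $G_1$ and the other in $G_2$) is a cograph; there are no other cographs. Linear time means time linear in the number of vertices plus the number of edges. *)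

(* Defs.v *)
From mathcomp Require Import all_boot all_order all_algebra.

Set Implicit Arguments.
Unset Strict Implicit.
Unset Printing Implicit Defensive.

Import Order.TTheory GRing.Theory Num.Theory.

Local Open Scope ring_scope.

(** * Graphs *)

Record sgraph := SGraph {
  vertex :> finType;
  edge : rel vertex;
  edge_sym : symmetric edge;
  edge_irr : irreflexive edge
}.

Definition edge_set (G : sgraph) : {set {set G}} :=
  [set A | [exists x, exists y, edge x y && (A == [set x; y])]].

Definition clique (G : sgraph) (K : {set G}) : bool :=
  [forall x in K, forall y in K, (x != y) ==> edge x y].

Definition clique_transversal (G : sgraph) (S : {set G}) : bool :=
  [forall K : {set G}, maxset (@clique G) K ==> (S :&: K != set0)].

Definition upper_clique_transversal (G : sgraph) (k : int) : bool :=
  [exists S : {set G}, minset (@clique_transversal G) S && (k <= #|S|%:Z)].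

(** * Cographs *)

Definition K1_edge : rel unit := fun _ _ => false.

Lemma K1_sym : symmetric K1_edge. Proof. by []. Qed.
Lemma K1_irr : irreflexive K1_edge. Proof. by []. Qed.

Definition K1 : sgraph := SGraph K1_sym K1_irr.

Section UnionJoin.
Variables G1 G2 : sgraph.

(* [b] tells whether the two sides are completely joined. *)
Definition sum_edge (b : bool) : rel (G1 + G2)%type := fun u v =>
  match u, v with
  | inl x, inl y => edge x y
  | inr x, inr y => edge x y
  | _, _ => b
  end.

Lemma sum_sym b : symmetric (sum_edge b).
Proof. by case=> x [] y //=; apply: edge_sym. Qed.

Lemma sum_irr b : irreflexive (sum_edge b).
Proof. by case=> x /=; apply: edge_irr. Qed.

Definition disjoint_union : sgraph := SGraph (sum_sym false) (sum_irr false).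
Definition join : sgraph := SGraph (sum_sym true) (sum_irr true).

End UnionJoin.

Definition isomorphic (G H : sgraph) : Prop :=
  exists2 f : G -> H, bijective f & {mono f : x y / edge x y}.

Inductive cograph : sgraph -> Prop :=
| cograph_K1 : cograph K1
| cograph_union G1 G2 :
    cograph G1 -> cograph G2 -> cograph (disjoint_union G1 G2)
| cograph_join G1 G2 : cograph G1 -> cograph G2 -> cograph (join G1 G2)
| cograph_iso G H : isomorphic G H -> cograph G -> cograph H.

(** * Random access machines

   The machine of Cook and Reckhow under the uniform cost measure: registers
   [X_0, X_1, ...] hold integers and are initially 0, the input is a finite
   sequence of integers read from left to right, and there is no
   multiplication.  Moreover words are bounded: writing an integer of absolute
   value greater than the word bound [w] is a fault. *)

Inductive instr :=
| Const of nat & int            (* X_i := z *)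
| Plus of nat & nat & nat       (* X_i := X_j + X_l *)
| Minus of nat & nat & nat      (* X_i := X_j - X_l *)
| Fetch of nat & nat            (* X_i := X_(X_j) *)
| Store of nat & nat            (* X_(X_i) := X_j *)
| Jpos of nat & nat             (* if X_j > 0 then go to instruction l *)
| Read of nat                   (* X_i := next input integer *)
| Halt of bool.                 (* stop with the given answer *)

Definition program := seq instr.

Record config := Config {
  pc : nat;
  input : seq int;
  reg : nat -> int
}.

Definition init (x : seq int) : config := Config 0 x (fun _ => 0).

(* [None] is a fault: word overflow, negative address, or exhausted input. *)
Definition exec (w : nat) (c : instr) (s : config) : option config :=
  let: Config p x X := s in
  let write x' a v :=
    if (`|v| <= w)%N
    then Some (Config p.+1 x' (fun b => if b == a then v else X b))
    else None in
  match c with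
  | Const i z => write x i z
  | Plus i j l => write x i (X j + X l)
  | Minus i j l => write x i (X j - X l)
  | Fetch i j => if X j is Posz a then write x i (X a) else None
  | Store i j => if X i is Posz a then write x a (X j) else None
  | Jpos j l => Some (Config (if 0 < X j then l else p.+1) x X)
  | Read i => if x is z :: x' then write x' i z else None
  | Halt _ => None
  end.

(* [run w P t s = Some b] iff [P], started in [s], reaches [Halt b] without
   fault after executing at most [t] instructions. *)
Fixpoint run (w : nat) (P : program) (t : nat) (s : config) : option bool :=
  if t is t'.+1 then
    match onth P (pc s) with
    | None => None
    | Some (Halt b) => Some b
    | Some c => obind (run w P t') (exec w c s)
    end
  else None.

(** * Linear time on graphs *)

(* A graph is presented to a machine by adjacency lists, with respect to an
   arbitrary numbering of its vertices (the position in [vs]), and each list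
   being in arbitrary order. *)
Definition adjacency_lists (G : sgraph) (vs : seq G) (adj : G -> seq G) : Prop :=
  [/\ uniq vs, vs =i predT &
      forall v, uniq (adj v) /\ adj v =i edge v].

Definition encode (G : sgraph) (vs : seq G) (adj : G -> seq G) (k : int) :
    seq int :=
  [:: k, (size vs)%:Z &
     flatten [seq (size (adj v))%:Z :: [seq (index u vs)%:Z | u <- adj v]
             | v <- vs]].

(* The word bound lets a word have [log (|V| + |E| + |k|) + O(1)] bits.  It may
   depend on [k], which has to fit in a word; the running time may not. *)
Definition linear_time_solvable
    (C : sgraph -> Prop) (Q : sgraph -> int -> bool) : Prop :=
  exists (P : program) (c : nat),
  forall (G : sgraph) (vs : seq G) (adj : G -> seq G) (k : int),
    C G -> adjacency_lists vs adj ->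
    run (c * (#|G| + #|edge_set G| + `|k|))%N P (c * (#|G| + #|edge_set G|))%N
      (init (encode vs adj k)) = Some (Q G k).

(* Main.v *)
Require Import Defs.
From mathcomp Require Import all_boot all_order all_algebra zify.

(** In a disjoint union the minimal clique transversals are the unions of one
   from each side, and in a join they are those of either side; so their maximum
   size is additive on unions and is the maximum on joins.  First-fit clique
   covers behave in the same way on cographs: whatever the order in which the
   vertices are treated, if each one is put in the first clique of the cover to
   which it is completely joined, then the number of cliques is additive on
   unions and the maximum on joins.  Hence this number, which a random access
   machine computes while it reads the adjacency lists once, is the upper clique
   transversal number. *)

Set Implicit Arguments.
Unset Strict Implicit.
Unset Printing Implicit Defensive.

(** * Clique transversals of unions and joins *)

Lemma cliqueP (G : sgraph) (K : {set G}) :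
  reflect {in K &, forall x y, x != y -> edge x y} (clique K).
Proof.
apply: (iffP forall_inP) => [cK x y xK yK | cK x xK].
  by move/forall_inP: (cK x xK) => /(_ y yK) /implyP.
by apply/forall_inP => y yK; apply/implyP; apply: cK.
Qed.

(** Quantifying over all cliques spares a description of the maximal ones: each clique extends to a
    maximal one, and a maximal clique only to itself. *)
Lemma transversalP (G : sgraph) (S : {set G}) :
  reflect (forall K, clique K ->
             exists2 M, clique M & K \subset M /\ exists2 x, x \in S & x \in M)
          (clique_transversal S).
Proof.
apply: (iffP forallP) => [tS K cK | tS K].
  have [M mM KM] := maxset_exists cK; exists M; first exact: maxsetp mM.
  split=> //; have /implyP/(_ mM)/set0Pn[x] := tS M.
  by rewrite inE => /andP[xS xM]; exists x.
apply/implyP => /maxsetP[cK mK].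
have [M cM [KM [x xS xM]]] := tS K cK.
by apply/set0Pn; exists x; rewrite inE xS -(mK M).
Qed.

Lemma non_transversal (G : sgraph) (S : {set G}) :
  ~~ clique_transversal S ->
  exists2 K, clique K &
    (forall M, clique M -> K \subset M -> M = K) /\ S :&: K = set0.
Proof.
rewrite negb_forall => /existsP[K]; rewrite negb_imply negbK.
by case/andP=> /maxsetP[cK mK] /eqP d; exists K.
Qed.

Lemma set0_transversal (G : sgraph) : ~~ clique_transversal (set0 : {set G}).
Proof.
apply/transversalP => /(_ set0) [|M _ [_ [x]]]; last by rewrite inE.
by apply/cliqueP => x y; rewrite inE.
Qed.

Definition max_min_transversal (G : sgraph) (m : nat) : Prop :=
  (exists2 S : {set G}, minset (@clique_transversal G) S & #|S| = m) /\
  (forall S : {set G}, minset (@clique_transversal G) S -> #|S| <= m).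

Lemma upper_clique_transversalE (G : sgraph) (m : nat) (k : int) :
  max_min_transversal G m -> upper_clique_transversal G k = (k <= m%:Z)%R.
Proof.
move=> [[S mS cS] le_m]; apply/existsP/idP => [[T /andP[mT kT]] | le_k].
  by have := le_m T mT; lia.
by exists S; rewrite mS cS.
Qed.

Lemma max_min_transversal_K1 : max_min_transversal K1 1.
Proof.
have cT : clique [set: K1] by apply/cliqueP => [[] []].
have tT : clique_transversal [set: K1].
  apply/transversalP => K _; exists [set: K1] => //; split; first exact: subsetT.
  by exists tt; rewrite inE.
have le1 (S : {set K1}) : #|S| <= 1.
  by rewrite (leq_trans (max_card _)) // card_unit.
split=> //; exists [set: K1]; last by rewrite cardsT card_unit.
apply/minsetP; split=> // S tS _; apply/setP => [[]]; rewrite inE.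
have [x xS] : exists x, x \in S; last by case: x xS.
by apply/set0Pn; apply: contraTneq tS => ->; apply: set0_transversal.
Qed.

(** * Invariance under isomorphism *)

Section Iso.
Variables (G H : sgraph) (f : G -> H) (g : H -> G).
Hypotheses (fK : cancel f g) (gK : cancel g f).
Hypothesis f_edge : {mono f : x y / edge x y}.

Lemma clique_preim (K : {set H}) : clique (f @^-1: K) = clique K.
Proof.
apply/cliqueP/cliqueP => cK x y; last first.
  by rewrite !inE -f_edge -(inj_eq (can_inj fK)); apply: cK.
rewrite -[x]gK -[y]gK f_edge (inj_eq (can_inj fK)) => xK yK.
by apply: cK; rewrite inE.
Qed.

Lemma preimK (S : {set G}) : f @^-1: (g @^-1: S) = S.
Proof. by apply/setP => x; rewrite !inE fK. Qed.

Lemma transversal_preim (S : {set H}) :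
  clique_transversal (f @^-1: S) = clique_transversal S.
Proof.
apply/transversalP/transversalP => tS K cK.
  have [|M cM [KM [x xS xM]]] := tS (f @^-1: K); first by rewrite clique_preim.
  exists (g @^-1: M); first by rewrite -clique_preim preimK.
  split; last by exists (f x); move: xS; rewrite !inE ?fK.
  by apply/subsetP => y yK; rewrite inE (subsetP KM) // inE gK.
have [|M cM [KM [x xS xM]]] := tS (g @^-1: K).
  by rewrite -clique_preim preimK.
exists (f @^-1: M); first by rewrite clique_preim.
split; last by exists (g x); rewrite inE gK.
by apply/subsetP => y yK; rewrite inE (subsetP KM) // inE fK.
Qed.
End Iso.

Lemma min_transversal_preim (G H : sgraph) (f : G -> H) (g : H -> G)
    (fK : cancel f g) (gK : cancel g f) (S : {set H}) :
  {mono f : x y / edge x y} ->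
  minset (@clique_transversal H) S ->
  minset (@clique_transversal G) (f @^-1: S) /\ #|f @^-1: S| = #|S|.
Proof.
move=> f_edge /minsetP[tS mS]; split; last first.
  by apply: on_card_preimset; exists g => x _; [apply: fK | apply: gK].
apply/minsetP; split; first by rewrite (transversal_preim fK gK).
move=> T tT /subsetP TS; rewrite -(preimK fK T) (mS (g @^-1: T)) //.
  by rewrite -(transversal_preim fK gK) // preimK.
by apply/subsetP => y; rewrite inE => /TS; rewrite inE gK.
Qed.

Lemma max_min_transversal_iso (G H : sgraph) (m : nat) :
  isomorphic G H -> max_min_transversal G m -> max_min_transversal H m.
Proof.
move=> [f [g fK gK] f_edge] [[S mS cS] le_m].
have g_edge : {mono g : x y / edge x y} by move=> x y; rewrite -f_edge !gK.
split=> [|T mT].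
  have [mS' cS'] := min_transversal_preim gK fK g_edge mS.
  by exists (g @^-1: S); rewrite ?cS'.
have [mT' <-] := min_transversal_preim fK gK f_edge mT.
exact: le_m.
Qed.

(** * Transversals of disjoint unions and joins *)

Section Sum.
Variables G1 G2 : sgraph.

(** [disjoint_union] and [join] are its instances at [false] and [true], up to conversion. *)
Definition sum_graph (b : bool) : sgraph :=
  SGraph (@sum_sym G1 G2 b) (@sum_irr G1 G2 b).

Definition glue (A : {set G1}) (B : {set G2}) : {set (G1 + G2)%type} :=
  [set x | match x with inl a => a \in A | inr b => b \in B end].

Lemma glueK (S : {set (G1 + G2)%type}) : glue (inl @^-1: S) (inr @^-1: S) = S.
Proof. by apply/setP => [[]] x; rewrite !inE. Qed.

Lemma glue_inl A B : inl @^-1: glue A B = A.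
Proof. by apply/setP => x; rewrite !inE. Qed.

Lemma glue_inr A B : inr @^-1: glue A B = B.
Proof. by apply/setP => x; rewrite !inE. Qed.

Lemma glueS A B A' B' :
  (glue A B \subset glue A' B') = (A \subset A') && (B \subset B').
Proof.
apply/subsetP/andP => [s | [/subsetP sA /subsetP sB] [] x]; last 2 first.
- by rewrite !inE; apply: sA.
- by rewrite !inE; apply: sB.
split; apply/subsetP => x xA.
  by have := s (inl x); rewrite !inE; apply.
by have := s (inr x); rewrite !inE; apply.
Qed.

Lemma card_glue A B : #|glue A B| = #|A| + #|B|.
Proof.
rewrite -!sum1_card big_sumType /=.
by congr (_ + _); apply: eq_bigl => x; rewrite inE.
Qed.

Lemma clique_glue b A B :
  @clique (sum_graph b) (glue A B) =
  [&& clique A, clique B & b || (A == set0) || (B == set0)].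
Proof.
apply/cliqueP/and3P => [cK | [/cliqueP cA /cliqueP cB cross] [x|x] [y|y]].
- split.
  + by apply/cliqueP => x y xA yA; apply: (cK (inl x) (inl y)); rewrite inE.
  + by apply/cliqueP => x y xA yA; apply: (cK (inr x) (inr y)); rewrite inE.
  have [_|/set0Pn[x xA]] := eqVneq A set0; first by rewrite orbT.
  have [_|/set0Pn[y yB]] := eqVneq B set0; first by rewrite orbT.
  by have := cK (inl x) (inr y); rewrite !inE xA yB /= => ->.
- by rewrite !inE; apply: cA.
- rewrite !inE => xA yB _ /=; case/orP: cross => [/orP[//|]|] /eqP E.
    by rewrite E inE in xA.
  by rewrite E inE in yB.
- rewrite !inE => xB yA _ /=; case/orP: cross => [/orP[//|]|] /eqP E.
    by rewrite E inE in yA.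
  by rewrite E inE in xB.
- by rewrite !inE; apply: cB.
Qed.

Lemma clique0 (G : sgraph) : clique (set0 : {set G}).
Proof. by apply/cliqueP => x y; rewrite inE. Qed.

Lemma clique1 (G : sgraph) (x : G) : clique [set x].
Proof. by apply/cliqueP => y z /set1P-> /set1P->; rewrite eqxx. Qed.

(** Maximal cliques missed on each side glue to a missed maximal clique. Conversely, a clique is
    extended on the side of the transversal and kept on the other. *)
Lemma transversal_join A B :
  @clique_transversal (sum_graph true) (glue A B) =
  clique_transversal A || clique_transversal B.
Proof.
apply/transversalP/orP => [tS | tAB K].
  apply/orP; rewrite -[_ || _]negbK negb_or; apply/negP => /andP[].
  case/non_transversal => K1 c1 [m1 d1] /non_transversal[K2 c2 [m2 d2]].
  have [|M] := tS (glue K1 K2); first by rewrite clique_glue c1 c2.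
  rewrite -[M]glueK clique_glue glueS => /and3P[cM1 cM2 _] [/andP[s1 s2]].
  rewrite (m1 _ cM1 s1) (m2 _ cM2 s2) => -[] [] x; rewrite !inE => xS xK.
    by have := in_set0 x; rewrite -d1 inE xS xK.
  by have := in_set0 x; rewrite -d2 inE xS xK.
rewrite -[K]glueK clique_glue => /and3P[c1 c2 _].
case: tAB => /transversalP t.
  have [M cM [sM [x xA xM]]] := t _ c1.
  exists (glue M (inr @^-1: K)); first by rewrite clique_glue cM c2.
  by rewrite glueS sM subxx; split=> //; exists (inl x); rewrite inE.
have [M cM [sM [x xA xM]]] := t _ c2.
exists (glue (inl @^-1: K) M); first by rewrite clique_glue cM c1.
by rewrite glueS sM subxx; split=> //; exists (inr x); rewrite inE.
Qed.

(** A nonempty clique of a union lies on one side, together with all its extensions. *)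
Lemma transversal_union A B (x1 : G1) (x2 : G2) :
  @clique_transversal (sum_graph false) (glue A B) =
  clique_transversal A && clique_transversal B.
Proof.
apply/transversalP/andP => [tS | [/transversalP tA /transversalP tB] K].
  split; apply/transversalP => K cK.
    (* An extension of the empty clique might escape to the other side, so a singleton takes its
       place; [nK'] then leaves [M] no vertex there. *)
    pose K' := if K == set0 then [set x1] else K.
    have cK' : clique K' by rewrite /K'; case: ifP => // _; apply: clique1.
    have sK' : K \subset K' by rewrite /K'; case: eqP => // ->; apply: sub0set.
    have nK' : K' != set0.
      by rewrite /K'; case: ifP => [_ | -> //]; apply/set0Pn; exists x1; rewrite inE.
    have [|M] := tS (glue K' set0); first by rewrite clique_glue cK' clique0 eqxx orbT.
    rewrite -[M]glueK clique_glue glueS => /and3P[c1 c2 /= c12] [/andP[s1 _] [x xS xM]].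
    have E : inr @^-1: M = set0.
      apply/eqP; case/orP: c12 => // /eqP E.
      by move: s1; rewrite E subset0 (negPf nK').
    exists (inl @^-1: M) => //; split; first exact: subset_trans sK' s1.
    move: xS xM; rewrite E; case: x => x; rewrite !inE // => xS xM.
    by exists x; rewrite ?inE.
  pose K' := if K == set0 then [set x2] else K.
  have cK' : clique K' by rewrite /K'; case: ifP => // _; apply: clique1.
  have sK' : K \subset K' by rewrite /K'; case: eqP => // ->; apply: sub0set.
  have nK' : K' != set0.
    by rewrite /K'; case: ifP => [_ | -> //]; apply/set0Pn; exists x2; rewrite inE.
  have [|M] := tS (glue set0 K'); first by rewrite clique_glue cK' clique0 eqxx.
  rewrite -[M]glueK clique_glue glueS => /and3P[c1 c2 /= c12] [/andP[_ s1] [x xS xM]].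
  have E : inl @^-1: M = set0.
    apply/eqP; case/orP: c12 => // /eqP E.
    by move: s1; rewrite E subset0 (negPf nK').
  exists (inr @^-1: M) => //; split; first exact: subset_trans sK' s1.
  move: xS xM; rewrite E; case: x => x; rewrite !inE // => xS xM.
  by exists x; rewrite ?inE.
rewrite -[K]glueK clique_glue => /and3P[c1 c2 /orP[]/eqP->].
  have [M cM [sM [x xA xM]]] := tB _ c2.
  exists (glue set0 M); first by rewrite clique_glue cM clique0 eqxx.
  by rewrite glueS sM subxx; split=> //; exists (inr x); rewrite inE.
have [M cM [sM [x xA xM]]] := tA _ c1.
exists (glue M set0); first by rewrite clique_glue cM clique0 eqxx orbT.
by rewrite glueS sM subxx; split=> //; exists (inl x); rewrite inE.
Qed.

Lemma min_transversal_union A B (x1 : G1) (x2 : G2) :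
  minset (@clique_transversal (sum_graph false)) (glue A B) =
  minset (@clique_transversal G1) A && minset (@clique_transversal G2) B.
Proof.
apply/minsetP/andP => [[] | [/minsetP[tA mA] /minsetP[tB mB]]].
  rewrite transversal_union // => /andP[tA tB] m.
  split; apply/minsetP; split=> // T tT sT.
    rewrite -(glue_inl T B) (m (glue T B)) ?glue_inl ?transversal_union ?tT //.
    by rewrite glueS sT subxx.
  rewrite -(glue_inr A T) (m (glue A T)) ?glue_inr ?transversal_union ?tT ?tA //.
  by rewrite glueS sT subxx.
rewrite transversal_union // tA tB; split=> // S.
rewrite -[S]glueK transversal_union // glueS => /andP[t1 t2] /andP[s1 s2].
by rewrite (mA _ t1 s1) (mB _ t2 s2).
Qed.

(** A transversal of one side is already one of the join, so minimality empties the other side.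
    Conversely, the empty part of a smaller transversal is ruled out by [set0_transversal]. *)
Lemma min_transversal_join A B :
  minset (@clique_transversal (sum_graph true)) (glue A B) =
  minset (@clique_transversal G1) A && (B == set0) ||
  minset (@clique_transversal G2) B && (A == set0).
Proof.
apply/minsetP/orP => [[] | ]; last first.
  case=> /andP[/minsetP[t m] /eqP->]; rewrite transversal_join t ?orbT; split=> // S;
    rewrite -[S]glueK transversal_join glueS subset0.
    case/orP => [t1 /andP[s /eqP->] | t2 /andP[_ /eqP E]]; first by rewrite (m _ t1 s).
    by move: t2; rewrite E (negPf (set0_transversal _)).
  case/orP => [t2 /andP[/eqP E _] | t1 /andP[/eqP-> s]]; last by rewrite (m _ t1 s).
  by move: t2; rewrite E (negPf (set0_transversal _)).
rewrite transversal_join => /orP[tA | tB] m; [left | right].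
  have E : glue A set0 = glue A B.
    by apply: m; rewrite ?transversal_join ?tA // glueS subxx sub0set.
  apply/andP; split; last by rewrite -(glue_inr A B) -E glue_inr.
  apply/minsetP; split=> // T tT sT.
  rewrite -(glue_inl T B) (m (glue T B)) ?glue_inl // ?transversal_join ?tT //.
  by rewrite glueS sT subxx.
have E : glue set0 B = glue A B.
  by apply: m; rewrite ?transversal_join ?tB ?orbT // glueS subxx sub0set.
apply/andP; split; last by rewrite -(glue_inl A B) -E glue_inl.
apply/minsetP; split=> // T tT sT.
rewrite -(glue_inr A T) (m (glue A T)) ?glue_inr // ?transversal_join ?tT ?orbT //.
by rewrite glueS sT subxx.
Qed.

Lemma max_min_transversal_union m1 m2 (x1 : G1) (x2 : G2) :
  max_min_transversal G1 m1 -> max_min_transversal G2 m2 ->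
  max_min_transversal (disjoint_union G1 G2) (m1 + m2).
Proof.
move=> [[S1 mS1 cS1] le1] [[S2 mS2 cS2] le2]; split=> [|S].
  by exists (glue S1 S2); rewrite ?min_transversal_union ?mS1 // card_glue cS1 cS2.
rewrite -[S]glueK min_transversal_union // => /andP[m1S m2S].
by rewrite card_glue leq_add ?le1 ?le2.
Qed.

Lemma max_min_transversal_join m1 m2 :
  max_min_transversal G1 m1 -> max_min_transversal G2 m2 ->
  max_min_transversal (join G1 G2) (maxn m1 m2).
Proof.
move=> [[S1 mS1 cS1] le1] [[S2 mS2 cS2] le2]; split=> [|S].
  case: (leqP m1 m2) => _.
    exists (glue set0 S2); last by rewrite card_glue cards0.
    by rewrite min_transversal_join mS2 eqxx orbT.
  exists (glue S1 set0); last by rewrite card_glue cards0 addn0.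
  by rewrite min_transversal_join mS1 eqxx.
rewrite -[S]glueK min_transversal_join card_glue => /orP[] /andP[m /eqP->];
  rewrite cards0 ?addn0 leq_max ?le1 ?le2 ?orbT //.
Qed.

End Sum.

(** * Grundy labellings of cographs by cliques *)

Lemma cograph_inhabited (G : sgraph) : cograph G -> exists x : G, true.
Proof.
elim=> [|G1 G2 _ [x _] _ _|G1 G2 _ [x _] _ _|G0 H [f _ _] _ [x _]].
- by exists tt.
- by exists (inl x).
- by exists (inl x).
- by exists (f x).
Qed.

(** A Grundy colouring of the complement: the outcome of first fit, without its order of vertices.
    Only labels that occur are compared, so the notion restricts to a side of a sum without
    renumbering. *)
Definition clique_grundy (G : sgraph) (c : G -> nat) : Prop :=
  (forall u v, u != v -> c u = c v -> edge u v) /\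
  (forall u v, c u < c v -> exists2 w, c w = c u & ~~ edge v w).

Definition nlabels (G : sgraph) (c : G -> nat) : nat := size (undup (codom c)).

Lemma nlabels_sub (G H : sgraph) (c : G -> nat) (d : H -> nat) :
  {subset codom c <= codom d} -> nlabels c <= nlabels d.
Proof.
move=> cd; apply: uniq_leq_size => [|l]; first exact: undup_uniq.
by rewrite !mem_undup; apply: cd.
Qed.

Section SumLabels.
Variables (G1 G2 : sgraph) (b : bool) (c : sum_graph G1 G2 b -> nat).
Hypothesis gc : clique_grundy c.
Let c1 (x : G1) := c (inl x).
Let c2 (x : G2) := c (inr x).

Lemma mem_codom_sum l : (l \in codom c) = (l \in codom c1) || (l \in codom c2).
Proof.
apply/codomP/orP => [[[] x ->]|].
- by left; apply: codom_f.
- by right; apply: (codom_f c2).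
by case=> /codomP[x ->]; [exists (inl x) | exists (inr x)].
Qed.

(** A witness cannot lie on the other side: in a union, sharing the label of [u] would force an edge
    across; in a join, it would be a neighbour of [v]. *)
Lemma grundy_inl : clique_grundy c1.
Proof.
case: gc => cc cg; split=> [u v uv /cc|u v /cg[[] w ew]]; first by apply.
  by exists w.
move: ew; rewrite /=; case: (b) c gc cc cg => // c' [cc' _] _ _ ew _.
by have := cc' (inr w) (inl u) isT ew.
Qed.

Lemma grundy_inr : clique_grundy c2.
Proof.
case: gc => cc cg; split=> [u v uv /cc|u v /cg[[] w ew]]; first by apply.
  move: ew; rewrite /=; case: (b) c gc cc cg => // c' [cc' _] _ _ ew _.
  by have := cc' (inl w) (inr u) isT ew.
by exists w.
Qed.

(** Equal labels force an edge, so the two sides share no label. *)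
Lemma nlabels_union : b = false -> nlabels c = nlabels c1 + nlabels c2.
Proof.
move=> b0; rewrite /nlabels -size_cat; apply/perm_size/uniq_perm.
- exact: undup_uniq.
- rewrite cat_uniq !undup_uniq andbT; apply/hasPn => l.
  rewrite !mem_undup => /codomP[v ->]; apply/codomP => -[u E].
  by case: gc => /(_ (inr v) (inl u) isT E) /=; rewrite b0.
by move=> l; rewrite mem_cat !mem_undup mem_codom_sum.
Qed.

(* A vertex of the last label has a non-neighbour of every smaller label, and
   in a join all of its non-neighbours lie on its own side. *)
Lemma nlabels_join (x : G1) : b = true -> nlabels c = maxn (nlabels c1) (nlabels c2).
Proof.
move=> b1; have [v _ maxv] := arg_maxnP c (erefl : predT (inl x)).
have le1 : nlabels c1 <= nlabels c.
  by apply: nlabels_sub => l; rewrite mem_codom_sum => ->.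
have le2 : nlabels c2 <= nlabels c.
  by apply: nlabels_sub => l; rewrite mem_codom_sum orbC => ->.
apply/eqP; rewrite eqn_leq geq_max le1 le2 !andbT leq_max; apply/orP.
case: gc => _ cg; case: v maxv => v maxv; [left | right].
  apply: nlabels_sub => l /codomP[u ->].
  have : c u <= c (inl v) := maxv u isT; rewrite leq_eqVlt => /predU1P[->|].
    exact: codom_f.
  by case/cg => -[] w <-; rewrite /= ?b1 // => _; apply: codom_f.
apply: nlabels_sub => l /codomP[u ->].
have : c u <= c (inr v) := maxv u isT; rewrite leq_eqVlt => /predU1P[->|].
  exact: (codom_f c2).
by case/cg => -[] w <-; rewrite /= ?b1 // => _; apply: (codom_f c2).
Qed.
End SumLabels.

(** Induction with [c] general, as the sides carry its restrictions. The number in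
    [max_min_transversal] being unique, all these labellings use equally many labels; hence first
    fit may treat the vertices in any order, without a cotree. *)
Theorem max_min_transversal_grundy (G : sgraph) (c : G -> nat) :
  cograph G -> clique_grundy c -> max_min_transversal G (nlabels c).
Proof.
move=> cG; elim: cG c => {G}
  [|G1 G2 cG1 IH1 cG2 IH2|G1 G2 cG1 IH1 _ IH2|G H iso_GH _ IH] c gc.
- have -> : nlabels c = size [:: c tt]; last exact: max_min_transversal_K1.
  apply/perm_size/uniq_perm; rewrite ?undup_uniq // => l.
  by rewrite mem_undup inE; apply/codomP/eqP => [[[]] | ->]; last exists tt.
- have [x1 _] := cograph_inhabited cG1; have [x2 _] := cograph_inhabited cG2.
  rewrite (@nlabels_union G1 G2 false c gc) //.
  apply: (max_min_transversal_union x1 x2); [apply: IH1 | apply: IH2].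
    exact: (@grundy_inl G1 G2 false).
  exact: (@grundy_inr G1 G2 false).
- have [x1 _] := cograph_inhabited cG1.
  rewrite (@nlabels_join G1 G2 true c gc x1) //.
  apply: max_min_transversal_join; [apply: IH1 | apply: IH2].
    exact: (@grundy_inl G1 G2 true).
  exact: (@grundy_inr G1 G2 true).
case: (iso_GH) => f [g fK gK] f_edge.
have -> : nlabels c = nlabels (c \o f).
  apply/eqP; rewrite eqn_leq !nlabels_sub // => l /codomP[x ->].
    exact: codom_f.
  by rewrite -[x]gK; apply: (codom_f (c \o f)).
apply: (max_min_transversal_iso iso_GH); apply: IH.
case: gc => cc cg; split=> [u v uv /cc | u v /cg[w ew]].
  by rewrite f_edge; apply; rewrite (inj_eq (can_inj fK)).
by rewrite -[w]gK f_edge; exists (g w); rewrite //= gK.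
Qed.

(** * First-fit clique covers *)

(** Double counting: sending [u] to [[set v; u]] injects the neighbours of [v] into the edges
    through [v], and an edge has at most two ends. *)
Lemma sum_degrees (G : sgraph) :
  \sum_(v : G) #|@edge G v| <= 2 * #|edge_set G|.
Proof.
apply: (@leq_trans (\sum_(v : G) \sum_(A in edge_set G) (v \in A))).
  apply: leq_sum => v _; rewrite -[X in _ <= X]big_mkcondr sum1_card.
  have inj : {in @edge G v &, injective (fun u => [set v; u])}.
    move=> u1 u2 vu1 vu2 /setP/(_ u1); rewrite !inE eqxx orbT => /esym/orP[]/eqP //.
    by move=> E; rewrite -topredE /= E edge_irr in vu1.
  rewrite -(card_in_imset inj); apply/subset_leq_card/subsetP => A /imsetP[u vu ->].
  rewrite unfold_in /= !inE eqxx andbT.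
  apply/existsP; exists v; apply/existsP; exists u; rewrite eqxx andbT; exact: vu.
rewrite exchange_big /= mulnC -sum_nat_const; apply: leq_sum => A.
rewrite inE => /existsP[x /existsP[y /andP[_ /eqP ->]]].
by rewrite -big_mkcond sum1_card cards2; case: (_ != _).
Qed.

Definition fupd (T : Type) (f : nat -> T) (a : nat) (v : T) : nat -> T :=
  fun b => if b == a then v else f b.

Lemma fupd_eq T (f : nat -> T) a v : fupd f a v a = v.
Proof. by rewrite /fupd eqxx. Qed.

Lemma fupd_neq T (f : nat -> T) a v b : (b == a) = false -> fupd f a v b = f b.
Proof. by rewrite /fupd => ->. Qed.

(* First-fit clique cover, one vertex at a time.  Label 0 means "not labelled
   yet"; [clock] is the number of list entries read before the current vertex,
   and [maxn (hits l) clock - clock] counts the neighbours of the current vertex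
   with label [l] met so far, so that the counters need no resetting. *)
Record state := State {
  current : nat;
  lab : nat -> nat;
  hits : nat -> nat;
  population : nat -> nat;
  fresh : nat;
  clock : nat
}.

(** A label is a candidate once its counted neighbours are as many as its clique has members; the
    smallest candidate is kept. *)
Definition visit (lb sz : nat -> nat) (t : nat) (s : (nat -> nat) * nat) (u : nat) :=
  let l := lb u in
  if l == 0 then s else
  let h := (maxn (s.1 l) t).+1 in
  (fupd s.1 l h, if (t + sz l <= h) && (l <= s.2) then l else s.2).

Definition place (s : state) (us : seq nat) : state :=
  let r := foldl (visit (lab s) (population s) (clock s)) (hits s, fresh s) us in
  State (current s).+1 (fupd (lab s) (current s) r.2) r.1
    (fupd (population s) r.2 (population s r.2).+1)
    (if r.2 < fresh s then fresh s else (fresh s).+1) (clock s + size us).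

Definition start : state :=
  State 0 (fun=> 0) (fun=> 0) (fun=> 0) 6 0.

(** Counters left by earlier vertices are at most [t], so [maxn] with [t] discards them. The last
    two clauses express first fit: the chosen label is [new] or full, and no full label that was hit
    is smaller. *)
Lemma visitsP lb sz t D new us :
  let r := foldl (visit lb sz t) (D, new) us in
  let c l := count (fun u => lb u == l) us in
  (forall l, D l <= t) ->
  [/\ forall l, l != 0 -> maxn (r.1 l) t = t + c l,
      forall l, r.1 l <= t + size us,
      r.2 <= new,
      r.2 = new \/ [/\ r.2 != 0, 0 < c r.2 & sz r.2 <= c r.2] &
      forall l, l != 0 -> 0 < c l -> sz l <= c l -> r.2 <= l].
Proof.
move=> /= Dt; elim/last_ind: us => [|us u [IH1 IH2 IH3 IH4 IH5]].
  split=> //= [l _ | l |]; rewrite ?addn0 //; [exact/maxn_idPr | by left].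
rewrite foldl_rcons size_rcons; set r := foldl _ _ _ in IH1 IH2 IH3 IH4 IH5 *.
have cE l : count (fun v => lb v == l) (rcons us u) =
            count (fun v => lb v == l) us + (lb u == l).
  by rewrite -cats1 count_cat /= addn0.
rewrite /visit; case: eqP => [lu0 | /eqP lu0].
  have cE' l : l != 0 -> count (fun v => lb v == l) (rcons us u) =
            count (fun v => lb v == l) us.
    by move=> l0; rewrite cE lu0 eq_sym (negPf l0) addn0.
  split=> //.
  - by move=> l l0; rewrite cE' // IH1.
  - by move=> l; rewrite (leq_trans (IH2 l)) // leq_add2l.
  - by case: IH4 => [|[r0 ? ?]]; [left | right; rewrite cE'].
  - by move=> l l0; rewrite cE' //; apply: IH5.
have Eu := IH1 _ lu0; split=> /=.
- move=> l l0; rewrite cE /fupd eq_sym; case: eqP => [<- | _]; first by lia.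
  by rewrite addn0 IH1.
- move=> l; rewrite /fupd; case: eqP => [_ | _]; have := IH2 l; have := IH2 (lb u); lia.
- by case: ifP => // /andP[_]; lia.
- case: ifP => [/andP[full _] | _].
    by right; rewrite cE eqxx; split=> //; lia.
  by case: IH4 => [|[r0 c0 cs]]; [left | right; rewrite cE; split=> //; lia].
move=> l l0; rewrite cE; case: (eqVneq (lb u) l) => [E | _].
  rewrite -E => _ full; case: ifP => // /negbT.
  by rewrite negb_and; lia.
rewrite addn0 => c0 cs; have := IH5 l l0 c0 cs; case: ifP => // /andP[_]; lia.
Qed.

Section FirstFit.
Variable ls : seq (seq nat).
Hypothesis ls_uniq : forall i, uniq (nth [::] ls i).
Hypothesis ls_sym : forall i j, (i \in nth [::] ls j) = (j \in nth [::] ls i).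

(** The loop invariant: [ff_clique] and [ff_grundy] amount to [clique_grundy] on the vertices placed
    so far, and [ff_hits] is what [visitsP] assumes. *)
Record first_fit (s : state) : Prop := FirstFit {
  ff_next : current s <= size ls;
  ff_clock : clock s = sumn (map size (take (current s) ls));
  ff_hits : forall l, hits s l <= clock s;
  ff_fresh : 6 <= fresh s <= 6 + current s;
  ff_lab : forall i, i < current s -> 6 <= lab s i < fresh s;
  ff_unlab : forall i, current s <= i -> lab s i = 0;
  ff_pop : forall l, l != 0 ->
     population s l = count (fun i => lab s i == l) (iota 0 (current s));
  ff_used : forall l, 6 <= l < fresh s -> exists2 i, i < current s & lab s i = l;
  ff_clique : forall i j, i < current s -> j < current s -> i != j ->
     lab s i = lab s j -> i \in nth [::] ls j;
  ff_grundy : forall i l, i < current s -> 6 <= l < lab s i ->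
     exists j, [/\ j < current s, lab s j = l & j \notin nth [::] ls i]
}.

Lemma start_first_fit : first_fit start.
Proof. by split=> //= [|l]; [rewrite take0 | lia]. Qed.

Lemma place_first_fit s :
  first_fit s -> current s < size ls -> first_fit (place s (nth [::] ls (current s))).
Proof.
case: s => n lb D sz new t [/= Hn Ht HD Hf Hl Hu Hp Hd Hc Hg] ltn.
rewrite /place /=; set us := nth [::] ls n.
have := @visitsP lb sz t D new us HD.
set r := foldl _ _ _; pose c l := count (fun u => lb u == l) us => visits.
have {visits} [_ r2 r3 r4 r5] : [/\ forall l, l != 0 -> maxn (r.1 l) t = t + c l,
      forall l, r.1 l <= t + size us, r.2 <= new,
      r.2 = new \/ [/\ r.2 != 0, 0 < c r.2 & sz r.2 <= c r.2] &
      forall l, l != 0 -> 0 < c l -> sz l <= c l -> r.2 <= l] := visits.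
(* A neighbour with a nonzero label is already placed. *)
have sub_full l : l != 0 ->
    {subset [seq i <- us | lb i == l] <= [seq i <- iota 0 n | lb i == l]}.
  move=> l0 i; rewrite !mem_filter mem_iota /= add0n => /andP[/eqP E _].
  by rewrite E eqxx; case: (ltnP i n) => // /Hu; rewrite E => Z; rewrite Z in l0.
(* Fullness means complete adjacency, by counting: the neighbours labelled [l] are distinct members
   of the clique, and as many as all members. *)
have full l : l != 0 -> sz l <= c l -> forall i, i < n -> lb i = l -> i \in us.
  move=> l0 szc i ltin E.
  have [] := @uniq_min_size _ [seq i <- us | lb i == l]
    [seq i <- iota 0 n | lb i == l] _ (sub_full l l0).
  - by rewrite filter_uniq // ls_uniq.
  - by rewrite !size_filter -(Hp l l0).
  move=> _ /(_ i); rewrite !mem_filter E eqxx mem_iota /= add0n ltin => ->; lia.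
have nfull l : 6 <= l < new -> c l < sz l -> exists j, [/\ j < n, lb j = l & j \notin us].
  move=> l6 cs; have l0 : l != 0 by lia.
  have [/allP /= all_us | /allPn[j]] :=
    boolP (all (mem us) [seq i <- iota 0 n | lb i == l]).
    suff : sz l <= c l by lia.
    rewrite (Hp l l0) -size_filter /c -size_filter; apply: uniq_leq_size => [|i].
      by rewrite filter_uniq // iota_uniq.
    move=> il; rewrite mem_filter all_us // andbT.
    by move: il; rewrite mem_filter => /andP[].
  by rewrite mem_filter mem_iota /= add0n => /andP[/eqP E ltj] jus; exists j.
(* The last clause of [visitsP] concerns only labels that were hit; a full label in use was hit,
   since its clique is nonempty. *)
have sz0 l : 6 <= l < new -> 0 < sz l.
  move=> l6; case: (Hd l l6) => i ltin E; rewrite Hp; last lia.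
  by rewrite -has_count; apply/hasP; exists i; rewrite ?mem_iota //= E.
have r26 : 6 <= r.2 <= new.
  rewrite r3 andbT; case: r4 => [-> | [+ + _]]; first lia.
  rewrite -has_count => + /hasP[u _ /eqP E]; rewrite -E.
  by case: (ltnP u n) => [/Hl|/Hu ->]; lia.
have r20 : r.2 != 0 by lia.
have sz_new : sz new = 0.
  rewrite Hp; last lia.
  apply/eqP; rewrite -leqn0 leqNgt -has_count; apply/hasPn => i.
  by rewrite mem_iota => /andP[_ /Hl]; lia.
have fupd_lt i : i < n -> fupd lb n r.2 i = lb i.
  by move=> ltin; rewrite fupd_neq //; lia.
have old_full i : i < n -> lb i = r.2 -> i \in us.
  move=> ltin E; have [E2 | [_ _ szc]] := r4.
    by have := Hl i ltin; rewrite E E2; lia.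
  exact: (full r.2).
split=> /=.
- exact: ltn.
- by rewrite (take_nth [::]) // map_rcons sumn_rcons -Ht.
- exact: r2.
- by case: ifP; lia.
- move=> i; rewrite ltnS leq_eqVlt => /predU1P[-> | ltin].
    by rewrite fupd_eq; case: ifP; lia.
  by rewrite fupd_lt //; have := Hl i ltin; case: ifP; lia.
- by move=> i lei; rewrite fupd_neq ?Hu //; lia.
- move=> l l0; rewrite -[RHS]/(count (fun i => fupd lb n r.2 i == l) (iota 0 n.+1)).
  rewrite -(addn1 n) iotaD count_cat /= !addn0 add0n fupd_eq.
  have -> : count (fun i => fupd lb n r.2 i == l) (iota 0 n) = sz l.
    rewrite Hp //; apply: eq_in_count => i; rewrite mem_iota => /andP[_ ltin].
    by rewrite fupd_lt.
  by rewrite /fupd eq_sym; case: eqP => [-> | _]; rewrite ?addn1 ?addn0.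
- move=> l l6; have [-> | /eqP nl] := eqVneq l r.2; first by exists n; rewrite ?fupd_eq.
  have [|i ltin E] := Hd l; first by move: l6; case: ifP; lia.
  by exists i; rewrite ?fupd_lt //; lia.
- move=> i j; rewrite !ltnS (leq_eqVlt i) (leq_eqVlt j).
  move=> /predU1P[-> | ltin] /predU1P[-> | ltjn].
  + by rewrite eqxx.
  + by move=> _; rewrite fupd_eq fupd_lt // ls_sym => E; apply: old_full.
  + by move=> _; rewrite fupd_eq fupd_lt // => E; apply: old_full.
  + by rewrite !fupd_lt //; apply: Hc.
move=> i l; rewrite ltnS leq_eqVlt => /predU1P[-> | ltin].
  rewrite fupd_eq => l6; have l0 : l != 0 by lia.
  have l6' : 6 <= l < new by lia.
  (* Were [l] full, the choice of the smallest full label would give [r.2 <= l]. *)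
  have [|j [ltjn E nj]] := nfull l l6'.
    rewrite ltnNge; apply/negP => szc; have szl := sz0 l l6'.
    by have := r5 l l0 (leq_trans szl szc) szc; lia.
  by exists j; rewrite fupd_lt //; split=> //; lia.
rewrite fupd_lt // => /(Hg i l ltin)[j [ltjn E nj]].
by exists j; rewrite fupd_lt //; split=> //; lia.
Qed.
Lemma foldl_first_fit s (s' := foldl place s (drop (current s) ls)) :
  first_fit s -> first_fit s' /\ current s' = size ls.
Proof.
rewrite {}/s'; move: {2}(size ls - _) (erefl (size ls - current s)) => m.
elim: m s => [|m IH] s Em ffs; have lec := ff_next ffs.
  have Ec : current s = size ls by lia.
  by rewrite Ec drop_size.
have {}lec : current s < size ls by lia.
rewrite (drop_nth [::] lec) /=; apply: (IH (place s _)); last exact: place_first_fit.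
by rewrite /=; lia.
Qed.

End FirstFit.

(** * The machine *)

(** Pads branches that are shorter than their time budget. *)
Lemma run_le w P t t' s b : t <= t' -> run w P t s = Some b -> run w P t' s = Some b.
Proof.
elim: t t' s => [|t IH] [|t'] s //= le_t.
case: (onth P (pc s)) => [c|] //.
suff E s' : obind (run w P t) s' = Some b -> obind (run w P t') s' = Some b.
  by case: c => // *; apply: E.
by case: s' => //= ?; apply: IH.
Qed.

#[local] Arguments run : simpl never.

(** * Execution of single instructions *)

Section Steps.
Variables (w : nat) (P : program) (t p : nat) (x : seq int) (X : nat -> int) (b : bool).

Lemma run_Const i (z : int) :
  onth P p = Some (Const i z) -> (`|z| <= w)%N ->
  run w P t (Config p.+1 x (fupd X i z)) = Some b ->
  run w P t.+1 (Config p x X) = Some b.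
Proof. by rewrite /run -/run => -> /= ->. Qed.

(** Here and in the next three lemmas the written value [z] comes with its own equation, so that
    registers hold closed forms rather than growing sums. *)
Lemma run_Plus i j l (z : int) :
  onth P p = Some (Plus i j l) -> (X j + X l)%R = z -> (`|z| <= w)%N ->
  run w P t (Config p.+1 x (fupd X i z)) = Some b ->
  run w P t.+1 (Config p x X) = Some b.
Proof. by rewrite /run -/run => -> /= -> ->. Qed.

Lemma run_Minus i j l (z : int) :
  onth P p = Some (Minus i j l) -> (X j - X l)%R = z -> (`|z| <= w)%N ->
  run w P t (Config p.+1 x (fupd X i z)) = Some b ->
  run w P t.+1 (Config p x X) = Some b.
Proof. by rewrite /run -/run => -> /= -> ->. Qed.

Lemma run_Fetch i j a (z : int) :
  onth P p = Some (Fetch i j) -> X j = a%:Z%R -> X a = z -> (`|z| <= w)%N ->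
  run w P t (Config p.+1 x (fupd X i z)) = Some b ->
  run w P t.+1 (Config p x X) = Some b.
Proof. by rewrite /run -/run => -> /= -> -> ->. Qed.

Lemma run_Store i j a (z : int) :
  onth P p = Some (Store i j) -> X i = a%:Z%R -> X j = z -> (`|z| <= w)%N ->
  run w P t (Config p.+1 x (fupd X a z)) = Some b ->
  run w P t.+1 (Config p x X) = Some b.
Proof. by rewrite /run -/run => -> /= -> -> ->. Qed.

Lemma run_jump j l :
  onth P p = Some (Jpos j l) -> (0 < X j)%R ->
  run w P t (Config l x X) = Some b ->
  run w P t.+1 (Config p x X) = Some b.
Proof. by rewrite /run -/run => -> /= ->. Qed.

Lemma run_nojump j l :
  onth P p = Some (Jpos j l) -> (X j <= 0)%R ->
  run w P t (Config p.+1 x X) = Some b ->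
  run w P t.+1 (Config p x X) = Some b.
Proof. by rewrite /run -/run => -> /=; rewrite Order.TotalTheory.leNgt => /negPf ->. Qed.

Lemma run_Halt a : onth P p = Some (Halt a) -> a = b ->
  run w P t.+1 (Config p x X) = Some b.
Proof. by rewrite /run -/run => -> ->. Qed.
End Steps.

Lemma run_Read w P t p x X b i (z : int) :
  onth P p = Some (Read i) -> (`|z| <= w)%N ->
  run w P t (Config p.+1 x (fupd X i z)) = Some b ->
  run w P t.+1 (Config p (z :: x) X) = Some b.
Proof. by rewrite /run -/run => -> /= ->. Qed.

(* Registers: 0 holds [k]; 1 the number of vertices still to be read; 2, 3, 13
   and 15 the constants 1, 3, 0 and 20; 4 the address of the label of the
   current vertex; 5 three times the fresh label; 6 the fresh label; 7 the
   clock; 8 three times the best label so far; 9 the number of entries still to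
   be read in the current list; 14 the clock of the next vertex.  The labels start at 6,
   so that the arrays, of stride 3, do not meet the registers: the label [l] of
   vertex [i] is kept as [3 * l] in register [3 * i + 20], and [hits l] and
   [population l] are in registers [3 * l] and [3 * l + 1]. *)
Definition first_fit_program : program :=
  [:: Read 0; Read 1; Const 2 1; Const 3 3; Const 4 20; Const 5 18; Const 6 6;
      Const 15 20;
      (* 8: next vertex, or compare [fresh - 6] with [k] *)
      Jpos 1 15; Minus 0 6 0; Const 12 5; Minus 0 0 12; Jpos 0 14;
      Halt false; Halt true;
      (* 15: start reading a list *)
      Minus 1 1 2; Read 9; Plus 8 5 13; Plus 14 7 9;
      (* 19: next entry, or label the current vertex *)
      Jpos 9 32; Store 4 8; Plus 4 4 3; Plus 7 14 13; Plus 12 8 2; Fetch 11 12;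
      Plus 11 11 2; Store 12 11; Minus 12 5 8; Jpos 12 8; Plus 5 5 3; Plus 6 6 2;
      Jpos 2 8;
      (* 32: visit a neighbour *)
      Minus 9 9 2; Read 10; Plus 11 10 10; Plus 11 11 10; Plus 11 11 15;
      Fetch 10 11; Jpos 10 40; Jpos 2 19;
      (* 40: it has a label *)
      Fetch 11 10; Minus 12 11 7; Jpos 12 44; Plus 11 7 13;
      Plus 11 11 2; Store 10 11; Plus 12 10 2; Fetch 12 12; Plus 12 12 7;
      Minus 12 12 11; Jpos 12 19; Minus 12 10 8; Jpos 12 19; Plus 8 10 13;
      Jpos 2 19].

(** Reads a register through pending updates; [lia] separates the addresses. The three arrays lie in
    distinct residue classes modulo 3 and, labels being at least 6, above register 15. *)
Ltac look := repeat (rewrite fupd_eq || (rewrite fupd_neq; [|by [] || lia])).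
Ltac arith := look; try lia.

(** * Correctness and running time of the program *)

Section Machine.
Variables (k : int) (ls : seq (seq nat)) (w : nat).
Hypothesis ls_uniq : forall i, uniq (nth [::] ls i).
Hypothesis ls_lt : forall i j, j \in nth [::] ls i -> j < size ls.
Hypothesis ls_sym : forall i j, (i \in nth [::] ls j) = (j \in nth [::] ls i).
Hypothesis ls_gt0 : 0 < size ls.
Let entries := sumn (map size ls).
(** All addresses and values are linear in these quantities; as there is a vertex, the factor 50
    also absorbs constants such as 20. *)
Hypothesis w_ge : 50 * (size ls + `|k|%N) + 2 * entries <= w.

(** Registers 1, 8 to 12 and 14 are left out: they belong to a loop or are scratch, and each lemma
    states those it needs. *)
Record layout (s : state) (X : nat -> int) : Prop := Layout {
  at0 : X 0 = k;
  at2 : X 2 = 1%Z;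
  at3 : X 3 = 3%Z;
  at4 : X 4 = (3 * current s + 20)%N%:Z%R;
  at5 : X 5 = (3 * fresh s)%N%:Z%R;
  at6 : X 6 = (fresh s)%:Z%R;
  at7 : X 7 = (clock s)%:Z%R;
  at13 : X 13 = 0%Z;
  at15 : X 15 = 20%Z;
  at_lab : forall i, X (3 * i + 20) = (3 * lab s i)%N%:Z%R;
  at_hits : forall l, 6 <= l -> X (3 * l) = (hits s l)%:Z%R;
  at_pop : forall l, 6 <= l -> X (3 * l + 1) = (population s l)%:Z%R
}.

(** In continuation style: [K] takes over whenever the machine is back at instruction 19. The
    longest path has 23 steps; 30 is a uniform budget. *)
Lemma run_visit nx lb sz D best new t (u r : nat) rest X b T :
  (forall i, lb i = 0 \/ 6 <= lb i <= 6 + size ls) ->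
  (forall l, 6 <= l -> sz l <= size ls) ->
  (forall l, D l < entries) -> t < entries -> u < size ls -> r < size ls ->
  6 <= best <= new -> new <= 6 + size ls ->
  layout (State nx lb D sz new t) X ->
  X 8 = (3 * best)%N%:Z%R -> X 9 = r.+1%:Z%R ->
  (forall X', layout (State nx lb (visit lb sz t (D, best) u).1 sz new t) X' ->
     X' 8 = (3 * (visit lb sz t (D, best) u).2)%N%:Z%R -> X' 9 = r%:Z%R ->
     X' 1 = X 1 -> X' 14 = X 14 ->
     run w first_fit_program T (Config 19 rest X') = Some b) ->
  run w first_fit_program (30 + T) (Config 19 (u%:Z%R :: rest) X) = Some b.
Proof.
move=> lbP szP DP tP uP rP bestP newP.
move=> [/= X0 X2 X3 X4 X5 X6 X7 X13 X15 Xlab Xhits Xpop] X8 X9 K.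
rewrite /visit in K.
apply: run_jump; [by [] | lia |].
apply: (@run_Minus _ _ _ _ _ _ _ _ _ _ r%:Z%R); [by [] | lia | lia |].
apply: run_Read; [by [] | lia |].
apply: (@run_Plus _ _ _ _ _ _ _ _ _ _ (2 * u)%N%:Z%R); [by [] | by arith | lia |].
apply: (@run_Plus _ _ _ _ _ _ _ _ _ _ (3 * u)%N%:Z%R); [by [] | by arith | lia |].
apply: (@run_Plus _ _ _ _ _ _ _ _ _ _ (3 * u + 20)%N%:Z%R); [by [] | by arith | lia |].
apply: (@run_Fetch _ _ _ _ _ _ _ _ _ (3 * u + 20) (3 * lb u)%N%:Z%R);
  [by [] | by arith | by look; rewrite Xlab | by have := lbP u; lia |].
case: eqP K => [lu0 | /eqP lu0] K.
  apply: run_nojump; [by [] | by arith |].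
  apply: run_jump; [by [] | by arith |].
  apply: (@run_le _ _ T); first lia.
  apply: K; try by look.
  by split=> /= [|||||||||i|l l6|l l6]; look; auto.
have lP : 6 <= lb u by case: (lbP u) => [E|/andP[]//]; rewrite E in lu0.
have := lbP u; have := DP (lb u); have := szP _ lP; set l := lb u in lu0 lP K *.
move=> szl Dl lP2.
set h := (maxn (D l) t).+1 in K.
(* Both outcomes of comparing the old counter with the clock meet at instruction 44, with the
   maximum in register 11. *)
suff K44 X' : layout (State nx lb D sz new t) X' -> X' 8 = (3 * best)%N%:Z%R ->
    X' 9 = r%:Z%R -> X' 10 = (3 * l)%N%:Z%R -> X' 11 = (maxn (D l) t)%:Z%R ->
    X' 1 = X 1 -> X' 14 = X 14 ->
    run w first_fit_program (15 + T) (Config 44 rest X') = Some b.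
  apply: run_jump; [by [] | by arith |].
  apply: (@run_Fetch _ _ _ _ _ _ _ _ _ (3 * l) (D l)%:Z%R);
    [by [] | by look | by look; auto | lia |].
  apply: (@run_Minus _ _ _ _ _ _ _ _ _ _ ((D l)%:Z - t%:Z)%R);
    [by [] | by arith | lia |].
  case: (ltnP t (D l)) => tD.
    apply: run_jump; [by [] | by arith |].
    apply: (@run_le _ _ (15 + T)); first lia.
    apply: K44; try by [look | arith].
    by split=> /= [|||||||||i|l' l6|l' l6]; look; auto.
  apply: run_nojump; [by [] | by arith |].
  apply: (@run_Plus _ _ _ _ _ _ _ _ _ _ t%:Z%R); [by [] | by arith | lia |].
  apply: (@run_le _ _ (15 + T)); first lia.
  apply: K44; try by [look | arith].
  by split=> /= [|||||||||i|l' l6|l' l6]; look; auto.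
move=> {X0 X2 X3 X4 X5 X6 X7 X13 X15 Xlab Xhits Xpop X8 X9}.
case=> /= X0 X2 X3 X4 X5 X6 X7 X13 X15 Xlab Xhits Xpop X8 X9 X10 X11 X1E X14E.
rewrite -X1E -X14E in K.
apply: (@run_Plus _ _ _ _ _ _ _ _ _ _ h%:Z%R); [by [] | by arith | lia |].
apply: (@run_Store _ _ _ _ _ _ _ _ _ (3 * l) h%:Z%R);
  [by [] | by look | by look | lia |].
apply: (@run_Plus _ _ _ _ _ _ _ _ _ _ (3 * l + 1)%N%:Z%R); [by [] | by arith | lia |].
apply: (@run_Fetch _ _ _ _ _ _ _ _ _ (3 * l + 1) (sz l)%:Z%R);
  [by [] | by look | by look; auto | lia |].
apply: (@run_Plus _ _ _ _ _ _ _ _ _ _ (t + sz l)%N%:Z%R); [by [] | by arith | lia |].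
apply: (@run_Minus _ _ _ _ _ _ _ _ _ _ ((t + sz l)%N%:Z - h%:Z)%R);
  [by [] | by arith | lia |].
(* For all exits: besides registers 8 to 12, only the cell of [hits l] has changed. *)
have layoutK X1 : (forall a, a < 8 \/ 12 < a /\ a != 3 * l -> X1 a = X' a) ->
    X1 (3 * l) = h%:Z%R -> layout (State nx lb (fupd D l h) sz new t) X1.
  move=> E El; split=> /= [|||||||||i|l' l6|l' l6]; try by rewrite E //; lia.
  - rewrite /fupd; case: eqP => [-> // | /eqP l'l]; rewrite E ?Xhits //.
    by right; split; lia.
  - by rewrite E ?Xpop //; lia.
case: (leqP (t + sz l) h) K => full /= K; last first.
  apply: run_jump; [by [] | by arith |].
  apply: (@run_le _ _ T); first lia.
  apply: K; try by look.
  by apply: layoutK => [a a_lt|]; look.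
apply: run_nojump; [by [] | by arith |].
apply: (@run_Minus _ _ _ _ _ _ _ _ _ _ ((3 * l)%N%:Z - (3 * best)%N%:Z)%R);
  [by [] | by arith | lia |].
case: (leqP l best) K => lbest /= K; last first.
  apply: run_jump; [by [] | by arith |].
  apply: (@run_le _ _ T); first lia.
  apply: K; try by look.
  by apply: layoutK => [a a_lt|]; look.
apply: run_nojump; [by [] | by arith |].
apply: (@run_Plus _ _ _ _ _ _ _ _ _ _ (3 * l)%N%:Z%R); [by [] | by arith | lia |].
apply: run_jump; [by [] | by arith |].
apply: (@run_le _ _ T); first lia.
apply: K; try by look.
by apply: layoutK => [a a_lt|]; look.
Qed.

(** The bounds by [entries] survive the induction: a visit lifts a counter at most one above the
    larger of itself and the clock, and uses up one entry. *)
Lemma run_visits nx lb sz new t (us : seq nat) rest D best X b T :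
  (forall i, lb i = 0 \/ 6 <= lb i <= 6 + size ls) ->
  (forall l, 6 <= l -> sz l <= size ls) ->
  (forall l, D l + size us <= entries) -> t + size us <= entries ->
  (forall u, u \in us -> u < size ls) -> size us <= size ls ->
  6 <= best <= new -> new <= 6 + size ls ->
  layout (State nx lb D sz new t) X ->
  X 8 = (3 * best)%N%:Z%R -> X 9 = (size us)%:Z%R ->
  (forall X', let r := foldl (visit lb sz t) (D, best) us in
     layout (State nx lb r.1 sz new t) X' ->
     X' 8 = (3 * r.2)%N%:Z%R -> X' 9 = 0%Z ->
     X' 1 = X 1 -> X' 14 = X 14 ->
     run w first_fit_program T (Config 19 rest X') = Some b) ->
  run w first_fit_program (30 * size us + T)
    (Config 19 ([seq u%:Z%R | u <- us] ++ rest) X) = Some b.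
Proof.
move=> lbP szP; elim: us D best X => [|u us IH] D best X DP tP uP rP bP newP layX X8 X9 K.
  exact: K.
have -> : 30 * size (u :: us) + T = 30 + (30 * size us + T) by rewrite /=; lia.
move: DP tP rP => /= DP tP rP.
apply: (@run_visit nx lb sz D best new t u (size us) _ X) => //.
- by move=> l; have := DP l; lia.
- lia.
- by apply: uP; rewrite mem_head.
move=> X' layX' X8' X9' X1' X14'.
have [h1 h2] : (forall l, (visit lb sz t (D, best) u).1 l + size us <= entries) /\
    6 <= (visit lb sz t (D, best) u).2 <= new.
  rewrite /visit; case: eqP => [_|/eqP lu0] /=; split=> //.
  - by move=> l; have := DP l; lia.
  - by move=> l; rewrite /fupd; have := DP l; have := DP (lb u); case: eqP; lia.
  - by have := lbP u; case: ifP; lia.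
apply: (IH _ (visit lb sz t (D, best) u).2 X') => //; try lia.
  by move=> v vus; apply: uP; rewrite inE vus orbT.
move=> X2; rewrite -surjective_pairing -X1' -X14' in K * => r *; exact: K.
Qed.

Lemma run_place s X rest T b (us := nth [::] ls (current s)) :
  first_fit ls s -> current s < size ls -> layout s X ->
  X 1 = (size ls - current s)%N%:Z%R ->
  (forall X', layout (place s us) X' -> X' 1 = (size ls - (current s).+1)%N%:Z%R ->
     run w first_fit_program T (Config 8 rest X') = Some b) ->
  run w first_fit_program (30 * (size us).+1 + T)
    (Config 8 ((size us)%:Z%R :: [seq u%:Z%R | u <- us] ++ rest) X) = Some b.
Proof.
case: s @us => n lb D sz new t us ffs ltn layX X1 K; rewrite /= in us ltn X1 K *.
have ffs' := place_first_fit ls_uniq ls_sym ffs ltn.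
have us_le : size us <= size ls.
  rewrite -[X in _ <= X](size_iota 0); apply: uniq_leq_size => [|u /ls_lt].
    exact: ls_uniq.
  by rewrite mem_iota.
have t_le : t + size us <= entries.
  rewrite [t](ff_clock ffs) /entries -{2}(cat_take_drop n ls) (drop_nth [::]) //.
  by rewrite map_cat sumn_cat /= -/us; lia.
have fresh_le := ff_fresh ffs; have hits_le := ff_hits ffs.
rewrite /= in fresh_le hits_le.
have labP i : lb i = 0 \/ 6 <= lb i <= 6 + size ls.
  by case: (ltnP i n) => [/(ff_lab ffs)|/(ff_unlab ffs)] /=; lia.
have popP l : 6 <= l -> sz l <= size ls.
  move=> l6; have /= -> := ff_pop ffs (_ : l != 0); last lia.
  by rewrite (leq_trans (count_size _ _)) // size_iota ltnW.
have [_ _ best_le _ _] := visitsP lb sz new us hits_le.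
have := ff_lab ffs' (ltnSn _); rewrite /= fupd_eq -/us => best_ge.
rewrite /place /= -/us in K.
set r := foldl _ _ _ in K best_le best_ge *; have rP : 6 <= r.2 by lia.
case: layX => /= X0 X2 X3 X4 X5 X6 X7 X13 X15 Xlab Xhits Xpop.
(* Five instructions open the list, 30 are allowed per entry, and 25 for labelling the vertex. *)
have -> : 30 * (size us).+1 + T = 5 + (30 * size us + (25 + T)) by lia.
apply: run_jump; [by [] | lia |].
apply: (@run_Minus _ _ _ _ _ _ _ _ _ _ (size ls - n.+1)%N%:Z%R);
    [by [] | by arith | lia |].
apply: run_Read; [by [] | lia |].
apply: (@run_Plus _ _ _ _ _ _ _ _ _ _ (3 * new)%N%:Z%R); [by [] | by arith | lia |].
apply: (@run_Plus _ _ _ _ _ _ _ _ _ _ (t + size us)%N%:Z%R); [by [] | by arith | lia |].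
apply: (@run_visits n lb sz new t us _ D new) => //; try by look.
- by move=> l; have := hits_le l; lia.
- by move=> u; apply: ls_lt.
- lia.
- lia.
- by split=> /= [|||||||||i|l l6|l l6]; look; auto.
look.
move=> X' /= []; rewrite -/r /=.
move=> {}X0 {}X2 {}X3 {}X4 {}X5 {}X6 {}X7 {}X13 {}X15 {}Xlab {}Xhits {}Xpop X8 X9 {}X1 X14.
move: X1 X14; look => X1 X14.
apply: run_nojump; [by [] | by arith |].
apply: (@run_Store _ _ _ _ _ _ _ _ _ (3 * n + 20) (3 * r.2)%N%:Z%R);
  [by [] | by look | by look | lia |].
apply: (@run_Plus _ _ _ _ _ _ _ _ _ _ (3 * n.+1 + 20)%N%:Z%R); [by [] | by arith | lia |].
apply: (@run_Plus _ _ _ _ _ _ _ _ _ _ (t + size us)%N%:Z%R); [by [] | by arith | lia |].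
apply: (@run_Plus _ _ _ _ _ _ _ _ _ _ (3 * r.2 + 1)%N%:Z%R); [by [] | by arith | lia |].
apply: (@run_Fetch _ _ _ _ _ _ _ _ _ (3 * r.2 + 1) (sz r.2)%:Z%R);
  [by [] | by look | by look; auto | by have := popP _ rP; lia |].
apply: (@run_Plus _ _ _ _ _ _ _ _ _ _ (sz r.2).+1%:Z%R);
  [by [] | by arith | by have := popP _ rP; lia |].
apply: (@run_Store _ _ _ _ _ _ _ _ _ (3 * r.2 + 1) (sz r.2).+1%:Z%R);
  [by [] | by look | by look | by have := popP _ rP; lia |].
apply: (@run_Minus _ _ _ _ _ _ _ _ _ _ ((3 * new)%N%:Z - (3 * r.2)%N%:Z)%R);
  [by [] | by arith | lia |].
(* Stated for any [new'], to serve both cases: an old clique is joined, or a new one opened. *)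
have layoutK X1' new' :
    X1' 5 = (3 * new')%N%:Z%R -> X1' 6 = new'%:Z%R ->
    X1' 4 = (3 * n.+1 + 20)%N%:Z%R -> X1' 7 = (t + size us)%N%:Z%R ->
    X1' (3 * n + 20) = (3 * r.2)%N%:Z%R -> X1' (3 * r.2 + 1) = (sz r.2).+1%:Z%R ->
    (forall a, a \notin [:: 4; 5; 6; 7; 11; 12; 3 * n + 20; 3 * r.2 + 1] ->
       X1' a = X' a) ->
    layout (State n.+1 (fupd lb n r.2) r.1 (fupd sz r.2 (sz r.2).+1) new'
              (t + size us)) X1'.
  move=> X5' X6' X4' X7' Xn Xr E.
  split=> //= [|||||i|l l6|l l6]; try by rewrite E // !inE; lia.
  - rewrite /fupd; case: eqP => [-> // | ?].
    by rewrite E ?Xlab // !inE; lia.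
  - by rewrite E ?Xhits // !inE; lia.
  - rewrite /fupd; case: eqP => [-> // | ?].
    by rewrite E ?Xpop // !inE; lia.
case: (ltnP r.2 new) K => lt_new K.
  apply: run_jump; [by [] | by arith |].
  apply: (@run_le _ _ T); first lia.
  apply: K; last by look.
  apply: layoutK => [|||||| a]; try by look.
  by rewrite !inE => aP; look.
apply: run_nojump; [by [] | by arith |].
apply: (@run_Plus _ _ _ _ _ _ _ _ _ _ (3 * new.+1)%N%:Z%R); [by [] | by arith | lia |].
apply: (@run_Plus _ _ _ _ _ _ _ _ _ _ new.+1%:Z%R); [by [] | by arith | lia |].
apply: run_jump; [by [] | by arith |].
apply: (@run_le _ _ T); first lia.
apply: K; last by look.
apply: layoutK => [|||||| a]; try by look.
by rewrite !inE => aP; look.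
Qed.

Definition entries_list (us : seq nat) : seq int :=
  (size us)%:Z%R :: [seq u%:Z%R | u <- us].

Lemma run_places s X :
  first_fit ls s -> layout s X -> X 1 = (size ls - current s)%N%:Z%R ->
  run w first_fit_program (30 * sumn [seq (size us).+1 | us <- drop (current s) ls] + 6)
    (Config 8 (flatten [seq entries_list us | us <- drop (current s) ls]) X)
  = Some (k <= (fresh (foldl place s (drop (current s) ls)) - 6)%N%:Z)%R.
Proof.
move: {2}(size ls - _) (erefl (size ls - current s)) => m.
elim: m s X => [|m IH] s X Em ffs layX X1.
  have lec := ff_next ffs; have Ec : current s = size ls by lia.
  rewrite Ec drop_size /= muln0 add0n.
  (* A jump tests strict positivity, hence the constant 5: over the integers [fresh - k - 5 > 0] is
     [k <= fresh - 6]. The natural subtraction is exact as [fresh] is at least 6. *)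
  have := ff_fresh ffs; case: layX => X0 X2 X3 X4 X5 X6 *.
  apply: run_nojump; [by [] | by rewrite X1; lia |].
  apply: (@run_Minus _ _ _ _ _ _ _ _ _ _ ((fresh s)%:Z - k)%R);
    [by [] | by rewrite X0 X6 | lia |].
  apply: run_Const; [by [] | lia |].
  apply: (@run_Minus _ _ _ _ _ _ _ _ _ _ ((fresh s)%:Z - k - 5)%R);
    [by [] | by look | lia |].
  case: (boolP (k <= (fresh s - 6)%N%:Z)%R) => le_k.
    by apply: run_jump; [by [] | arith | apply: run_Halt].
  by apply: run_nojump; [by [] | arith | apply: run_Halt].
have lec : current s < size ls by lia.
rewrite (drop_nth [::] lec) /=.
have ffs' := place_first_fit ls_uniq ls_sym ffs lec.
rewrite mulnDr -addnA; apply: run_place => // X' layX' X1'.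
have Em' : size ls - current (place s (nth [::] ls (current s))) = m by rewrite /=; lia.
exact: (IH _ X' Em' ffs' layX' X1').
Qed.

(** The 14 extra steps are 8 for initialisation and 6 for the final comparison. *)
Lemma run_first_fit :
  run w first_fit_program (30 * (size ls + entries) + 14)
    (init (k :: (size ls)%:Z%R :: flatten [seq entries_list us | us <- ls]))
  = Some (k <= (fresh (foldl place start ls) - 6)%N%:Z)%R.
Proof.
have -> : 30 * (size ls + entries) + 14 =
    8 + (30 * sumn [seq (size us).+1 | us <- ls] + 6).
  suff -> : sumn [seq (size us).+1 | us <- ls] = size ls + entries by lia.
  by rewrite /entries; elim: (ls) => //= us s ->; lia.
rewrite /init.
apply: run_Read; [by [] | lia |].
apply: run_Read; [by [] | lia |].
do 6 (apply: run_Const; [by [] | lia |]).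
set X := fupd _ _ _; have layX : layout start X.
  by split=> //= [i|l l6|l l6]; rewrite /X; look.
have := run_places (start_first_fit ls) layX; rewrite /= subn0 drop0; apply.
by rewrite /X; look.
Qed.

End Machine.

(** * Numbered graphs *)

Section Numbering.
Variables (G : sgraph) (vs : seq G) (adj : G -> seq G) (x0 : G).
Hypothesis adjP : adjacency_lists vs adj.

Definition index_lists : seq (seq nat) :=
  [seq [seq index u vs | u <- adj v] | v <- vs].

Lemma size_index_lists : size index_lists = #|G|.
Proof.
case: adjP => uvs vsE _.
by rewrite size_map -(card_uniqP uvs) (eq_card vsE).
Qed.

Lemma mem_numbering v : v \in vs.
Proof. by case: adjP => _ ->. Qed.

Lemma mem_index_lists i j :
  (i \in nth [::] index_lists j) =
  [&& i < #|G|, j < #|G| & edge (nth x0 vs j) (nth x0 vs i)].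
Proof.
rewrite -size_index_lists size_map; case: adjP => uvs vsE adjE.
have [ltj|lej] := ltnP j (size vs); last first.
  by rewrite nth_default ?size_map // andbF.
have adjEj u : (u \in adj (nth x0 vs j)) = edge (nth x0 vs j) u.
  by case: (adjE (nth x0 vs j)).
rewrite (nth_map x0) //; apply/mapP/andP => [[u] | [lti eij]].
  by rewrite adjEj => eu ->; rewrite index_mem mem_numbering nth_index ?mem_numbering.
by exists (nth x0 vs i); rewrite ?adjEj // index_uniq.
Qed.

Lemma index_lists_uniq i : uniq (nth [::] index_lists i).
Proof.
case: (ltnP i (size vs)) => [lti|lei]; last by rewrite nth_default ?size_map.
case: adjP => _ _ adjE; rewrite (nth_map x0) // map_inj_in_uniq.
  by case: (adjE (nth x0 vs i)).
by move=> u v _ _ E; rewrite -(nth_index x0 (mem_numbering u)) E nth_index ?mem_numbering.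
Qed.

Lemma sumn_index_lists : sumn (map size index_lists) <= 2 * #|edge_set G|.
Proof.
case: adjP => uvs vsE adjE; apply: leq_trans (sum_degrees G).
have <- : \sum_(v <- vs) #|@edge G v| = \sum_(v : G) #|@edge G v|.
  apply: perm_big; apply: uniq_perm; rewrite ?index_enum_uniq // => v.
  by rewrite vsE mem_index_enum.
rewrite sumnE !big_map /=; apply: leq_sum => v _.
by case: (adjE v) => uv vE; rewrite size_map -(card_uniqP uv) (eq_card vE).
Qed.

Lemma encodeE k :
  encode vs adj k =
  k :: (size index_lists)%:Z%R :: flatten [seq entries_list us | us <- index_lists].
Proof.
rewrite /encode size_map; congr [:: _, _ & flatten _].
rewrite /index_lists -[RHS]map_comp; apply: eq_map => v.
by rewrite /= /entries_list size_map -map_comp.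
Qed.

Let s := foldl place start index_lists.
Let c (v : G) := lab s (index v vs).

Lemma first_fit_index_lists : first_fit index_lists s /\ current s = #|G|.
Proof.
have := foldl_first_fit index_lists_uniq _ (start_first_fit index_lists).
rewrite /= drop0 size_index_lists; apply=> i j.
by rewrite !mem_index_lists edge_sym andbCA.
Qed.

Lemma clique_grundy_first_fit : clique_grundy c.
Proof.
have [ff cur] := first_fit_index_lists.
have lt_index v : index v vs < current s.
  by rewrite cur -size_index_lists size_map index_mem mem_numbering.
have nthK v : nth x0 vs (index v vs) = v by rewrite nth_index ?mem_numbering.
split=> [u v neq_uv cuv | u v cuv].
  have /(_ (lt_index u) (lt_index v)) := ff_clique ff _ _ _ cuv.
  rewrite mem_index_lists !nthK edge_sym; case/(_ _)/and3P=> //.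
  by apply: contraNneq neq_uv => E; rewrite -(nthK u) E nthK.
have /andP[cu _] := ff_lab ff (lt_index u).
have [|i [lti ci ni]] := ff_grundy ff (lt_index v) (l := c u); first by rewrite cu.
have Ei : index (nth x0 vs i) vs = i.
  case: adjP => uvs _ _; rewrite index_uniq //.
  by rewrite cur -size_index_lists size_map in lti.
exists (nth x0 vs i); first by rewrite /c Ei.
by apply: contraNN ni => e; rewrite mem_index_lists -cur lti lt_index nthK.
Qed.

(** By [ff_lab] and [ff_used] the labels in use are exactly those from 6 up to [fresh s],
    exclusive. *)
Lemma nlabels_first_fit : nlabels c = fresh s - 6.
Proof.
have [ff cur] := first_fit_index_lists.
rewrite -(size_iota 6 (fresh s - 6)).
apply/perm_size/uniq_perm; rewrite ?undup_uniq ?iota_uniq // => l.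
rewrite mem_undup mem_iota subnKC; last by case/andP: (ff_fresh ff).
apply/codomP/idP => [[v ->]|/(ff_used ff)[i lti Ei]].
  by apply: (ff_lab ff); rewrite cur -size_index_lists size_map index_mem mem_numbering.
exists (nth x0 vs i); rewrite /c index_uniq //.
  by rewrite cur -size_index_lists size_map in lti.
by case: adjP.
Qed.

End Numbering.

Theorem theorem6p1 : linear_time_solvable cograph upper_clique_transversal.
Proof.
(* For [n > 0] vertices and [m] edges the lists have at most [2m] entries, so the time
   [30 * (n + 2m) + 14] and the word bound [50 * (n + |k|) + 4m] fit the factor 100. *)
exists first_fit_program, 100 => G vs adj k cG adjP.
have [x0 _] := cograph_inhabited cG.
have := max_min_transversal_grundy cG (clique_grundy_first_fit x0 adjP).
rewrite (nlabels_first_fit x0 adjP) => /upper_clique_transversalE->.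
rewrite encodeE.
have n_gt0 : 0 < #|G| by apply/card_gt0P; exists x0.
have := sumn_index_lists adjP => entries_le.
apply: run_le (run_first_fit _ _ _ _ _).
- by rewrite (size_index_lists adjP); lia.
- exact: index_lists_uniq.
- move=> i j; rewrite (mem_index_lists x0 adjP) (size_index_lists adjP).
  by case/andP.
- by move=> i j; rewrite !(mem_index_lists x0 adjP) edge_sym andbCA.
- by rewrite (size_index_lists adjP).
- by rewrite (size_index_lists adjP); lia.
Qed.
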